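(* Let $f:\mathbb{R}\to\mathbb{R}$ be a strictly convex function whose minimum is attained at a (finite) point $u^{\min}\in\mathbb{R}$. Then for all real numbers $u_j^n, u_{j+1}^n$, the Godunov flux $\hat f_{j+\frac12}$ associated with $(u_j^n,u_{j+1}^n)$ satisfies $$ \hat f_{j+\frac12}=\max\left\{f\left(\mathrm{ReLU}(u^{n}_j-u^{\min})+u^{\min}\right),\; f\left(-\mathrm{ReLU}(u^{\min}-u^{n}_{j+1})+u^{\min}\right)\right\}. $$
   Context: $\mathrm{ReLU}(x)=\max\{x,0\}$ for $x\in\mathbb{R}$. For $f:\mathbb{R}\to\mathbb{R}$ and real numbers $u_j^n,u_{j+1}^n$, the Godunov flux is $$ \hat f_{j+\frac12}=\begin{cases}\max\limits_{u\in[u^n_{j+1},u^n_j]} f(u) & \text{if } u^n_{j+1}\le u^n_j,\\[4pt] \min\limits_{u\in[u^n_j,u^n_{j+1}]} f(u) & \text{if } u^n_j\le u^n_{j+1}.\end{cases} $$ *)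

(* Defs.v *)
From HB Require Import structures.
From mathcomp Require Import all_boot all_order all_algebra.
From mathcomp Require Import boolp classical_sets set_interval reals.

Set Implicit Arguments.
Unset Strict Implicit.
Unset Printing Implicit Defensive.

Import Order.TTheory GRing.Theory Num.Theory.
Local Open Scope classical_set_scope.
Local Open Scope ring_scope.

Definition ReLU (R : realType) (x : R) : R := Num.max x 0.

Definition strictly_convex (R : realType) (f : R -> R) : Prop :=
  forall x y t : R, x != y -> 0 < t -> t < 1 ->
    f (t * x + (1 - t) * y) < t * f x + (1 - t) * f y.

(* The maximum and the minimum are relations rather than total functions (such
   as [sup] and [inf]), so that asserting them includes attainment. *)
Definition is_max_on (R : realType) (f : R -> R) (D : set R) (v : R) : Prop :=
  (f @` D) v /\ ubound (f @` D) v.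

Definition is_min_on (R : realType) (f : R -> R) (D : set R) (v : R) : Prop :=
  (f @` D) v /\ lbound (f @` D) v.

(* [is_godunov_flux f ul ur v]: [v] is the Godunov flux of [f] for the left
   state [ul] and the right state [ur]. If [ul = ur] both clauses apply, and
   both say [v = f ul]. *)
Definition is_godunov_flux (R : realType) (f : R -> R) (ul ur v : R) : Prop :=
  (ur <= ul -> is_max_on f `[ur, ul] v) /\
  (ul <= ur -> is_min_on f `[ul, ur] v).

Lemma is_godunov_flux_unique (R : realType) (f : R -> R) (ul ur v w : R) :
  is_godunov_flux f ul ur v -> is_godunov_flux f ul ur w -> v = w.
Proof.
move=> [vM vm] [wM wm]; apply/eqP; rewrite eq_le.
have [h|/ltW h] := leP ur ul.
  have [[fv uv] [fw uw]] := (vM h, wM h).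
  by apply/andP; split; [exact: uw | exact: uv].
have [[fv lv] [fw lw]] := (vm h, wm h).
by apply/andP; split; [exact: lv | exact: lw].
Qed.

(* Main.v *)
Require Import Defs.
From HB Require Import structures.
From mathcomp Require Import all_boot all_order all_algebra.
From mathcomp Require Import boolp classical_sets set_interval reals.
From mathcomp Require Import ring lra.

Set Implicit Arguments.
Unset Strict Implicit.
Unset Printing Implicit Defensive.

Import Order.TTheory GRing.Theory Num.Theory.
Local Open Scope classical_set_scope.
Local Open Scope ring_scope.

(** The two arguments of [f] in the formula are [max ul umin] and
    [min ur umin] ([ReLU_shift_max], [ReLU_shift_min]), and a convex function
    with a minimizer [umin] decreases up to [umin] and increases after it
    ([convex_incr_right], [convex_decr_left]). So on [[ur, ul]] the part right
    of [umin] is dominated by [f (max ul umin)] and the part left of it by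
    [f (min ur umin)]; when one part is empty, its bound degenerates to the
    global minimum [f umin] and drops out of the outer maximum, so that the
    value is always attained at an endpoint. On [[ul, ur]]
    at least one of the two arguments is [umin], so that the outer maximum is
    the other value: [f] at the endpoint nearest to [umin] if [umin] is outside
    the interval, and [f umin] otherwise. *)

Lemma ReLU_shift_max (R : realType) (a m : R) :
  ReLU (a - m) + m = Num.max a m.
Proof. by rewrite /ReLU addr_maxl subrK add0r. Qed.

Lemma ReLU_shift_min (R : realType) (a m : R) :
  - ReLU (m - a) + m = Num.min a m.
Proof. by rewrite /ReLU oppr_max opprB oppr0 addr_minl subrK add0r. Qed.

Section ConvexWithMinimizer.
Variables (R : realType) (f : R -> R) (m : R).
Hypothesis f_convex : strictly_convex f.
Hypothesis f_min : forall u : R, f m <= f u.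

(** Convexity bounds [f y] by a weighted mean of [f x] and [f m], and
    [f m <= f x]; the weight of [x] is the ratio of the distances of [y]
    and [x] to [m]. *)
Lemma convex_le_between (x y : R) :
  0 < (y - m) / (x - m) -> (y - m) / (x - m) < 1 -> f y <= f x.
Proof.
set t := (y - m) / (x - m) => t0 t1.
have xm : x != m.
  by apply: contraTneq t0 => xm; rewrite /t xm subrr invr0 mulr0 ltxx.
have ty : t * x + (1 - t) * m = y.
  by rewrite /t; field; rewrite subr_eq0.
rewrite -{1}ty; apply: le_trans (ltW (f_convex xm t0 t1)) _.
have := f_min x; nra.
Qed.

Lemma convex_incr_right (x y : R) : m <= y -> y <= x -> f y <= f x.
Proof.
rewrite le_eqVlt => /predU1P[<- _|my]; first exact: f_min.
rewrite le_eqVlt => /predU1P[->//|yx].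
have xm0 : 0 < x - m by lra.
by apply: convex_le_between; rewrite ?ltr_pdivrMr ?divr_gt0 //; lra.
Qed.

Lemma convex_decr_left (x y : R) : x <= y -> y <= m -> f y <= f x.
Proof.
rewrite le_eqVlt => /predU1P[->//|xy].
rewrite le_eqVlt => /predU1P[->|ym]; first exact: f_min.
have xm0 : x - m < 0 by lra.
apply: convex_le_between; first by rewrite nmulr_rgt0 ?invr_lt0 //; lra.
by rewrite ltr_ndivrMr //; lra.
Qed.

Lemma max_on_valley (a b : R) : a <= b ->
  is_max_on f `[a, b] (Num.max (f (Num.max b m)) (f (Num.min a m))).
Proof.
move=> ab; split; last first.
  move=> _ [u /= /[!in_itv]/= /andP[au ub] <-]; rewrite le_max.
  have [mu|/ltW um] := leP m u; apply/orP.
    by left; rewrite max_l ?(le_trans mu) //; exact: convex_incr_right.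
  by right; rewrite min_l ?(le_trans au) //; exact: convex_decr_left.
(* Attainment: the maximum is one of the two endpoint values. *)
have fa : (f @` `[a, b]) (f a) by exists a; rewrite //= in_itv/= lexx.
have fb : (f @` `[a, b]) (f b) by exists b; rewrite //= in_itv/= lexx andbT.
have [bm|/ltW mb] := leP b m.
  by rewrite (min_l (le_trans ab bm)) max_r.
have [am|ma] := leP a m; last by rewrite max_l.
by have [_|_] := leP (f b) (f a).
Qed.

Lemma min_on_valley (a b : R) : a <= b ->
  is_min_on f `[a, b] (Num.max (f (Num.max a m)) (f (Num.min b m))).
Proof.
move=> ab; have [am|ma] := leP a m; last first.
  rewrite min_r ?(le_trans (ltW ma)) // max_l //.
  split; first by exists a; rewrite //= in_itv/= lexx.
  move=> _ [u /= /[!in_itv]/= /andP[au _] <-].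
  exact: convex_incr_right (ltW ma) au.
rewrite max_r //; have [bm|mb] := leP b m.
  split; first by exists b; rewrite //= in_itv/= lexx andbT.
  move=> _ [u /= /[!in_itv]/= /andP[_ ub] <-].
  exact: convex_decr_left ub bm.
split; first by exists m; rewrite //= in_itv/= am ltW.
by move=> _ [u _ <-].
Qed.

End ConvexWithMinimizer.

Theorem proposition1 (R : realType) (f : R -> R) (umin : R)
    (f_strictly_convex : strictly_convex f)
    (f_min_at_umin : forall u : R, f umin <= f u)
    (ul ur : R) :
  is_godunov_flux f ul ur
    (Num.max (f (ReLU (ul - umin) + umin))
             (f (- ReLU (umin - ur) + umin))).
Proof.
rewrite ReLU_shift_max ReLU_shift_min; split => h.
  exact: max_on_valley.
exact: min_on_valley.
Qed.
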